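(* Let $\varrho_h^0\in Q_h$, $\mathbf u_h^0\in \boldsymbol Q_h$ be the cell averages of the initial data, with $\varrho_h^0>0$. For $1\le n\le N$ let $\mathbf u_h^n\in\boldsymbol Q_h$, and let $\varrho_h^n\in Q_h$ be a solution of the discrete mass equation: for all $0\le n\le N-1$ and $K\in\mathcal T_h$, $$\frac{\varrho_{K}^{n+1}-\varrho_{K}^{n}}{\Delta t^n} + \big(\mathrm{div}_h(\varrho_h^{n+1}\mathbf{u}_h^{n+1})\big)_K - \sum_{\sigma\in\mathcal E(K)}\frac{|\sigma|}{|K|}\lambda_{\sigma}\,[\![\varrho_h^{n+1}]\!]_{\sigma,K} = 0 .$$ Suppose periodic boundary conditions hold. Let $B$ be a continuously differentiable convex function on $\mathbb R$, and suppose that at each time step the diffusion coefficient satisfies, for each face $\sigma=K|L$, $$\lambda_{\sigma} = \max\left\{ 1_{[\![\varrho_h^{n+1}]\!]_{\sigma}\ne0,\ [\![B'(\varrho_h^{n+1})]\!]_\sigma\neq 0}\ \frac{[\![\varrho_h^{n+1}]\!]_{\sigma}^2\;[\![B''(\varrho_*^{n+1})\mathbf u_h^{n+1}]\!]_\sigma\cdot\mathbf n_\sigma}{4\,[\![B'(\varrho_h^{n+1})]\!]_\sigma[\![\varrho_h^{n+1}]\!]_\sigma},\ \frac{|\mathbf u_L^{n+1}\cdot\mathbf n_{\sigma,K}|}{2},\ \frac{|\mathbf u_K^{n+1}\cdot\mathbf n_{\sigma,L}|}{2}\right\},$$ where $1_{(\cdot)}$ is the indicator of the set of faces with $[\![\varrho_h^{n+1}]\!]_\sigma\neq0$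 and $[\![B'(\varrho_h^{n+1})]\!]_\sigma\ne0$ (the first entry is $0$ on other faces). Then $\varrho_h^n>0$ for all $1\le n\le N$.
   Context: Mesh. $d\in\{1,2,3\}$, $\Omega=\mathbb T^d$ (periodic boundary conditions). $\mathcal T_h$ is a finite regular, quasi-uniform mesh of $\Omega$ by compact polygons/polyhedra (intervals if $d=1$); two distinct elements meet in the empty set or in a common face, edge or vertex. $\mathcal E(K)$ is the set of faces of $K$, $\mathcal E$ the set of all faces; by periodicity every face $\sigma=K|L$ is shared by two elements $K,L$. $\mathbf n_{\sigma,K}$ is the unit normal of $\sigma$ pointing out of $K$, so $\mathbf n_{\sigma,K}=-\mathbf n_{\sigma,L}$. $|K|$, $|\sigma|$ are the $d$- and $(d-1)$-dimensional Lebesgue measures. Discrete functions. $Q_h$ is the space of functions constant on each $K\in\mathcal T_h$ (value on $K$ written $\phi_K$), $\boldsymbol Q_h=Q_h^d$. For $\sigma=K|L$: $[\![\phi_h]\!]_{\sigma,K}=\phi_L-\phi_K$, $\{\!\{\phi_h\}\!\}_\sigma=(\phi_K+\phi_L)/2$. Expressions $[\![\phi]\!]_\sigma[\![\psi]\!]_\sigma$ and $[\![\boldsymbol\varphi]\!]_\sigma\cdot\mathbf n_\sigma$ are computed with $[\![\cdot]\!]_{\sigma,K}$ and $\mathbf n_\sigma=\mathbf n_{\sigma,K}$; they do not depend on which of the two elements is called $K$. $(\mathrm{div}_h\boldsymbol\varphi_h)_K=\sum_{\sigma\in\mathcal E(K)}\frac{|\sigma|}{|K|}\{\!\{\boldsymbol\varphi_h\}\!\}_\sigma\cdot\mathbf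 n_{\sigma,K}$. Time. $0=t^0<t^1<\dots<t^N=T$, $\Delta t^n=t^{n+1}-t^n$. The coefficients $\lambda_\sigma=\lambda_{\sigma,K}=\lambda_{\sigma,L}\ge0$ may depend on the time step. Initial values: $\varrho_K^0=\frac1{|K|}\int_K\varrho^0\,dx$, $\mathbf u_K^0=\frac1{|K|}\int_K\mathbf u^0\,dx$. Meaning of $B''(\varrho_*^{n+1})$. For $\sigma=K|L$ with $[\![\varrho_h^{n+1}]\!]_\sigma\ne0$, the numbers $B''(\varrho^{n+1}_{*,K}),B''(\varrho^{n+1}_{*,L})\ge0$ are those determined by $$B''(\varrho^{n+1}_{*,L})\tfrac12[\![\varrho_h^{n+1}]\!]_\sigma^2=[\![B(\varrho_h^{n+1})]\!]_{\sigma,K}-B'(\varrho_K^{n+1})[\![\varrho_h^{n+1}]\!]_{\sigma,K},$$ $$B''(\varrho^{n+1}_{*,K})\tfrac12[\![\varrho_h^{n+1}]\!]_\sigma^2=[\![B(\varrho_h^{n+1})]\!]_{\sigma,L}-B'(\varrho_L^{n+1})[\![\varrho_h^{n+1}]\!]_{\sigma,L},$$ (second derivatives at points between $\varrho_K^{n+1}$ and $\varrho_L^{n+1}$ when $B$ is twice differentiable), and $[\![B''(\varrho_*^{n+1})\mathbf u_h^{n+1}]\!]_\sigma\cdot\mathbf n_\sigma=\big(B''(\varrho^{n+1}_{*,L})\mathbf u_L^{n+1}-B''(\varrho^{n+1}_{*,K})\mathbf u_K^{n+1}\big)\cdot\mathbf n_{\sigma,K}$. *)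

(* Defs.v *)
From HB Require Import structures.
From mathcomp Require Import all_boot all_order all_algebra.
From mathcomp Require Import all_classical all_reals all_analysis.

Set Implicit Arguments.
Unset Strict Implicit.
Unset Printing Implicit Defensive.

Import Order.TTheory GRing.Theory Num.Theory.
Import numFieldNormedType.Exports.

Local Open Scope classical_set_scope.
Local Open Scope ring_scope.

Lemma sigma_finite_prod d1 d2 (T1 : measurableType d1) (T2 : measurableType d2)
    (R : realType) (m1 : {sigma_finite_measure set T1 -> \bar R})
    (m2 : {sigma_finite_measure set T2 -> \bar R}) :
  sigma_finite [set: T1 * T2] (m1 \x m2)%E.
Proof.
have /sigma_finiteP[F [TF ndF Foo]] := sigma_finiteT m1.
have /sigma_finiteP[G [TG ndG Goo]] := sigma_finiteT m2.
exists (fun n => F n `*` G n).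
  rewrite -setXTT TF TG predeqE => -[x y]; split.
    move=> [/= [n _ Fnx] [k _ Gky]]; exists (maxn n k) => //; split.
    - by move: x Fnx; exact/subsetPset/ndF/leq_maxl.
    - by move: y Gky; exact/subsetPset/ndG/leq_maxr.
  by move=> [n _ []/= ? ?]; split; exists n.
move=> k; have [? ?] := Foo k; have [? ?] := Goo k.
split; first exact: measurableX.
by rewrite product_measure1E// lte_mul_pinfty// ge0_fin_numE.
Qed.

(* Lebesgue measure on R^n, carried by the measurable type of n-tuples: the    *)
(* one-dimensional Lebesgue measure is multiplied by the n-dimensional one and *)
(* transported by (x, t) |-> x :: t; in dimension 0 the point has measure 1.   *)
Section LebesgueN.
Variable R : realType.
Notation RM := (measurableTypeR R).

Definition tcons n (p : RM * n.-tuple RM) : n.+1.-tuple RM :=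
  [tuple of p.1 :: p.2].

Lemma measurable_tcons n : measurable_fun [set: RM * n.-tuple RM] (@tcons n).
Proof.
by apply: measurable_cons; [exact: measurable_fst | exact: measurable_snd].
Qed.

Section step.
Variables (n : nat) (mu : {sigma_finite_measure set (n.-tuple RM) -> \bar R}).

Definition leb_step : set (n.+1.-tuple RM) -> \bar R :=
  pushforward (@lebesgue_measure R \x mu)%E (@tcons n).

Let leb_step0 : leb_step set0 = 0%E.
Proof. by rewrite /leb_step /pushforward preimage_set0 measure0. Qed.

Let leb_step_ge0 A : (0 <= leb_step A)%E.
Proof. by rewrite /leb_step /pushforward measure_ge0. Qed.

Let leb_step_sigma_additive : semi_sigma_additive leb_step.
Proof.
move=> F mF tF mUF.
apply: (@measure_semi_sigma_additive _ _ _ (pushforward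
  (@lebesgue_measure R \x mu)%E (@tcons n))) => //.
exact: measurable_tcons.
Qed.

HB.instance Definition _ := isMeasure.Build _ _ _ leb_step
  leb_step0 leb_step_ge0 leb_step_sigma_additive.

Let leb_step_sigma_finite : sigma_finite [set: n.+1.-tuple RM] leb_step.
Proof.
have [F TF Foo] := sigma_finite_prod (@lebesgue_measure R) mu.
pose u (t : n.+1.-tuple RM) : RM * n.-tuple RM := (thead t, behead_tuple t).
have uK p : u (tcons p) = p.
  case: p => x t; rewrite /u /tcons /= theadE; congr (_, _); exact: val_inj.
have mu' : measurable_fun [set: n.+1.-tuple RM] u.
  apply: measurable_fun_pair; first exact: measurable_tnth.
  exact: measurable_behead.
exists (fun i => u @^-1` F i).
  by rewrite -preimage_bigcup -TF preimage_setT.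
move=> i; have [mF Fi] := Foo i; split.
  by rewrite -[X in measurable X]setTI; exact: mu'.
rewrite /leb_step /pushforward (_ : _ @^-1` _ = F i)//.
by apply/seteqP; split=> p /=; rewrite uK.
Qed.

HB.instance Definition _ := Measure_isSigmaFinite.Build _ _ _ leb_step
  leb_step_sigma_finite.

End step.

Fixpoint leb n : {sigma_finite_measure set (n.-tuple RM) -> \bar R} :=
  if n is n'.+1 return {sigma_finite_measure set (n.-tuple RM) -> \bar R}
  then leb_step (leb n') else dirac [tuple].

End LebesgueN.

Section Euclidean.
Variables (R : realType) (d : nat).
Implicit Types (u v x y : 'rV[R]_d) (A : set 'rV[R]_d).

Definition dot u v : R := (u *m v^T) 0 0.

(* The norm `|x| of the library on row vectors is the max-norm. *)
Definition enorm x : R := Num.sqrt (dot x x).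

Definition diam A : R :=
  sup [set r | exists x y, [/\ A x, A y & r = enorm (x - y)]].

Definition row_of (t : d.-tuple (measurableTypeR R)) : 'rV[R]_d :=
  \row_i tnth t i.

Definition volume A : R := fine (leb R d (row_of @^-1` A)).

Definition integrable_over A (f : 'rV[R]_d -> R) : Prop :=
  (leb R d).-integrable (row_of @^-1` A) (EFin \o (f \o row_of)).

Definition integral_over A (f : 'rV[R]_d -> R) : R :=
  (\int[leb R d]_(t in row_of @^-1` A) f (row_of t))%R.

(* The torus T^d is R^d / Z^d: its functions are the Z^d-periodic functions on *)
(* R^d, and its subsets are handled as Z^d-periodic subsets of R^d.  [torus A] *)
(* is the image of A in T^d.                                                   *)
Definition shift (z : 'rV[int]_d) : 'rV[R]_d := map_mx intr z.

Definition periodic (T : Type) (f : 'rV[R]_d -> T) : Prop :=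
  forall x z, f (x + shift z) = f x.

Definition torus A : set 'rV[R]_d := [set x | exists z, A (x + shift z)].

End Euclidean.

(* A k-dimensional compact flat set in R^d: the isometric image of a regular   *)
(* compact subset [body] of R^k with connected interior, under the embedding   *)
(* y |-> origin + y *m frame (the rows of [frame] are orthonormal).            *)
Record flat_set (R : realType) (d k : nat) := FlatSet {
  origin : 'rV[R]_d;
  frame : 'M[R]_(k, d);
  body : set 'rV[R]_k;
  frame_orthonormal : frame *m frame^T = 1%:M;
  body_compact : compact body;
  body_regular : closure (interior body) = body;
  body_interior_nonempty : interior body !=set0;
  body_interior_connected : connected (interior body) }.

Section FlatSet.
Variables (R : realType) (d k : nat) (P : flat_set R d k).

Definition embed (y : 'rV[R]_k) : 'rV[R]_d := origin P + y *m frame P.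

Definition carrier : set 'rV[R]_d := embed @` body P.

Definition relint : set 'rV[R]_d := embed @` interior (body P).

Definition relboundary : set 'rV[R]_d :=
  embed @` (body P `\` interior (body P)).

(* k-dimensional Lebesgue measure *)
Definition flat_measure : R := volume (body P).

End FlatSet.

(* A finite polyhedral decomposition of T^d.  The entities of dimension d, d-1,*)
(* d-2, d-3 are (representatives in R^d of) the elements, faces, edges and     *)
(* vertices; for d = 2 the faces are the edges, for d = 1 they are the         *)
(* vertices.  Since the boundary of each entity is a finite union of entities  *)
(* of one dimension less, all of them are compact polytopes (not necessarily   *)
(* convex): intervals, polygons, polyhedra.                                    *)
Record decomposition (R : realType) (d : nat) := Decomposition {
  entity : finType;
  edim : entity -> nat;
  shape : forall e, flat_set R d (edim e);
  entity_embedded : forall e x z,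
    carrier (shape e) x -> carrier (shape e) (x + shift R z) -> z = 0;
  entity_disjoint : forall e f, e <> f ->
    torus (relint (shape e)) `&` torus (relint (shape f)) = set0;
  entity_boundary : forall e, torus (relboundary (shape e)) =
    \bigcup_(f in [set f | (edim f).+1 = edim e /\
                     torus (carrier (shape f)) `<=` torus (carrier (shape e))])
      torus (carrier (shape f));
  entity_cover : forall x, exists2 e, edim e = d & torus (carrier (shape e)) x }.

Section Decomposition.
Variables (R : realType) (d : nat) (D : decomposition R d).

Definition cell : finType := {e : entity D | edim e == d}.
Definition face : finType := {e : entity D | (edim e).+1 == d}.

Definition cell_set (K : cell) : set 'rV[R]_d := carrier (shape (val K)).
Definition face_set (s : face) : set 'rV[R]_d := carrier (shape (val s)).

(* The set E(K) of the faces of K. *)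
Definition faces (K : cell) : {set face} :=
  [set s | `[< torus (face_set s) `<=` torus (cell_set K) >]]%SET.

End Decomposition.

Record mesh (R : realType) (d : nat) := Mesh {
  mesh_decomp :> decomposition R d;
  cells_meet : forall K L : cell mesh_decomp, K <> L ->
    torus (cell_set K) `&` torus (cell_set L) = set0 \/
    exists2 e : entity mesh_decomp, (edim e < d)%N &
      torus (cell_set K) `&` torus (cell_set L) = torus (carrier (shape e));
  face_two_cells : forall s : face mesh_decomp,
    #|[set K : cell mesh_decomp | s \in faces K]%SET| = 2;
  normal : face mesh_decomp -> cell mesh_decomp -> 'rV[R]_d;
  normal_unit : forall K s, s \in faces K -> enorm (normal s K) = 1;
  normal_orthogonal : forall K s, s \in faces K ->
    frame (shape (val s)) *m (normal s K)^T = 0;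
  normal_outward : forall K s x, s \in faces K -> relint (shape (val s)) x ->
    exists2 eps, 0 < eps & forall t, 0 < t < eps ->
      ~ torus (cell_set K) (x + t *: normal s K);
  normal_opposite : forall K L s, s \in faces K -> s \in faces L -> K <> L ->
    normal s K = - normal s L;
  (* For a single finite mesh, regularity and quasi-uniformity just record a   *)
  (* constant [mesh_theta].                                                    *)
  mesh_theta : R;
  mesh_theta_gt0 : 0 < mesh_theta;
  mesh_regular : forall K : cell mesh_decomp, exists c, forall x,
    enorm (x - c) <= mesh_theta * diam (cell_set K) -> cell_set K x;
  mesh_quasi_uniform : forall K L : cell mesh_decomp,
    mesh_theta * diam (cell_set L) <= diam (cell_set K) }.

Section Discrete.
Variables (R : realType) (d : nat) (M : mesh R d).

(* Q_h and its vector-valued version *)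
Definition Qh := cell M -> R.
Definition Qhd := cell M -> 'rV[R]_d.

Implicit Types (K : cell M) (s : face M) (q : Qh) (v : Qhd).

Definition cell_measure K : R := volume (cell_set K).
Definition face_measure s : R := flat_measure (shape (val s)).

(* The element L such that s = K|L, when s is a face of K. *)
Definition neighbor s K : cell M :=
  odflt K [pick L | (s \in faces L) && (L != K)].

Definition jump q s K : R := q (neighbor s K) - q K.

Definition avg v s K : 'rV[R]_d := 2^-1 *: (v K + v (neighbor s K)).

Definition div_h v : Qh := fun K =>
  \sum_(s in faces K) face_measure s / cell_measure K *
    dot (avg v s K) (normal s K).

Definition initial_datum (f : 'rV[R]_d -> R) : Prop :=
  periodic f /\ forall K, integrable_over (cell_set K) f.

Definition cell_average (f : 'rV[R]_d -> R) : Qh := fun K =>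
  (cell_measure K)^-1 * integral_over (cell_set K) f.

Definition cell_average_vec (f : 'rV[R]_d -> 'rV[R]_d) : Qhd := fun K =>
  \row_j cell_average (fun x => f x 0 j) K.

Definition mass_equation (dt : R) (rho rho' : Qh) (u' : Qhd) (lam : face M -> R) :=
  forall K,
    (rho' K - rho K) / dt + div_h (fun L => rho' L *: u' L) K
    - \sum_(s in faces K)
        face_measure s / cell_measure K * lam s * jump rho' s K = 0.

Variable B : R -> R.

(* For r = rho_K and r' = rho_L this is B'' at rho_{*,L}, that is, the number  *)
(* b determined by                                                             *)
(*   b * (1/2) * (r' - r)^2 = B r' - B r - B'(r) * (r' - r).                   *)
Definition second_diff (r r' : R) : R :=
  (B r' - B r - derive1 B r * (r' - r)) / (2^-1 * (r' - r) ^+ 2).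

(* [[ B''(rho_star) u ]]_s . n_s *)
Definition jump_B2u (rho : Qh) (u : Qhd) s K : R :=
  let L := neighbor s K in
  dot (second_diff (rho K) (rho L) *: u L - second_diff (rho L) (rho K) *: u K)
      (normal s K).

Definition diffusion_coef (rho : Qh) (u : Qhd) s K : R :=
  let L := neighbor s K in
  let jrho := jump rho s K in
  let jB' := jump (fun K' => derive1 B (rho K')) s K in
  Num.max
    (Num.max
      (if (jrho != 0) && (jB' != 0)
       then jrho ^+ 2 * jump_B2u rho u s K / (4 * jB' * jrho) else 0)
      (`|dot (u L) (normal s K)| / 2))
    (`|dot (u K) (normal s L)| / 2).

End Discrete.

(* Main.v *)
Require Import Defs.
From mathcomp Require Import all_boot all_order all_algebra.
From mathcomp Require Import all_classical all_reals all_analysis.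
From mathcomp Require Import ring lra.
Set Implicit Arguments.
Unset Strict Implicit.
Import Order.TTheory GRing.Theory Num.Theory.
Import numFieldNormedType.Exports.
Local Open Scope classical_set_scope.
Local Open Scope ring_scope.

(** The diffusion coefficient is at least [|u . n| / 2] for the velocities on
    both sides of a face ([diffusion_coef_ge]).  This makes the implicit mass
    equation upwind-like: the flux leaving [K] through [s = K|L],
      [|s| ((u_K . n / 2 + lambda) rho_K + (u_L . n / 2 - lambda) rho_L)],
    is nondecreasing in [rho_K] and nonincreasing in [rho_L].

    Suppose the density is positive at one time step and let [S] be the set of
    cells where the next density is [<= 0].  Sum the mass balance over [S].
    Fluxes between two cells of [S] cancel, because the scheme is conservative
    ([numerical_flux_opp]); a flux from a cell of [S] to a cell outside [S] is
    [<= 0] by monotonicity ([numerical_flux_le0]).  Hence the new mass of [S],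
    which is [<= 0], is at least its old mass, which is positive unless [S] is
    empty ([conservative_scheme_gt0]).  Induction on time concludes.

    The argument weights cells by their measures, which must be positive.  This
    follows from the positivity of the initial density, a cell average that
    would vanish on a cell of measure zero ([cell_measure_gt0]). *)

(** The net flux out of [S] is at most [0]: through a face inside [S] the two
    contributions cancel, and through a face on the boundary of [S] the only
    contribution goes from a nonpositive value to a positive one. *)
Lemma outflow_nonpositive_cells_le0 (R : realDomainType) (C E : finType)
    (inc : C -> {set E}) (F : E -> C -> R) (q : C -> R) :
  (forall s, #|[set K | s \in inc K]%SET| = 2) ->
  (forall s K L, s \in inc K -> s \in inc L -> K != L -> F s L = - F s K) ->
  (forall s K L, s \in inc K -> s \in inc L -> K != L ->
    q K <= 0 -> 0 < q L -> F s K <= 0) ->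
  \sum_(K | q K <= 0) \sum_(s in inc K) F s K <= 0.
Proof.
move=> two opp mono.
rewrite (exchange_big_dep xpredT) //=; apply: sumr_le0 => s _.
have /eqP/cards2P[K [L [neKL eqKL]]] := two s.
have [sK sL] : (s \in inc K) /\ (s \in inc L).
  by split; move/setP: eqKL; [move/(_ K) | move/(_ L)];
    rewrite !inE eqxx ?orbT.
rewrite (eq_bigl (fun J => (J \in [set K; L]%SET) && (q J <= 0))); last first.
  by move=> J; rewrite -eqKL inE andbC.
rewrite big_mkcondr /= big_setU1 ?inE //= big_set1.
have [qK|qK] := leP (q K) 0; have [qL|qL] := leP (q L) 0.
- by rewrite (opp s K L) // subrr.
- by rewrite addr0 (mono s K L).
- by rewrite add0r (mono s L K) // eq_sym.
- by rewrite addr0.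
Qed.

Lemma conservative_scheme_gt0 (R : realDomainType) (C E : finType)
    (inc : C -> {set E}) (m : C -> R) (dt : R) (F : E -> C -> R)
    (q q' : C -> R) :
  0 < dt -> (forall K, 0 < m K) -> (forall K, 0 < q K) ->
  (forall s, #|[set K | s \in inc K]%SET| = 2) ->
  (forall s K L, s \in inc K -> s \in inc L -> K != L -> F s L = - F s K) ->
  (forall s K L, s \in inc K -> s \in inc L -> K != L ->
    q' K <= 0 -> 0 < q' L -> F s K <= 0) ->
  (forall K, m K * q' K + dt * (\sum_(s in inc K) F s K) = m K * q K) ->
  forall K, 0 < q' K.
Proof.
move=> dt0 m0 q0 two opp mono bal K; rewrite ltNge; apply/negP => qK.
have old : 0 < \sum_(J | q' J <= 0) m J * q J.
  rewrite (bigD1 K) //= ltr_pwDl ?mulr_gt0 //.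
  by apply: sumr_ge0 => J _; rewrite ltW ?mulr_gt0.
have new : \sum_(J | q' J <= 0) m J * q' J <= 0.
  by apply: sumr_le0 => J qJ; rewrite mulr_ge0_le0 // ltW.
have out := @outflow_nonpositive_cells_le0 R C E inc F q' two opp mono.
move: old; rewrite -(eq_bigr _ (fun J _ => bal J)) big_split /= -mulr_sumr.
by rewrite ltNge -[X in _ <= X]addr0 lerD // mulr_ge0_le0 // ltW.
Qed.

Section DotProduct.
Variables (R : realType) (d : nat).
Implicit Types (u v w : 'rV[R]_d) (a : R).

Lemma dotDl u v w : dot (u + v) w = dot u w + dot v w.
Proof. by rewrite /dot mulmxDl mxE. Qed.

Lemma dotZl a u w : dot (a *: u) w = a * dot u w.
Proof. by rewrite /dot -scalemxAl mxE. Qed.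

Lemma dotNr u w : dot u (- w) = - dot u w.
Proof. by rewrite /dot linearN /= mulmxN mxE. Qed.

End DotProduct.

Lemma volume_ge0 (R : realType) (d : nat) (A : set 'rV[R]_d) : 0 <= volume A.
Proof. exact/fine_ge0/measure_ge0. Qed.

Section MassFlux.
Variables (R : realType) (d : nat) (M : mesh R d).
Implicit Types (K L : cell M) (s : face M) (rho : Qh M) (u : Qhd M).

Lemma neighborE s K L :
  s \in faces K -> s \in faces L -> K != L -> neighbor s K = L.
Proof.
move=> sK sL neKL; rewrite /neighbor; case: pickP => [J /andP[sJ neJK]|no] /=.
  have /eqP/cards2P[X [Y [neXY eqXY]]] := face_two_cells s.
  have mem I : s \in faces I -> (I == X) || (I == Y).
    by move=> sI; move/setP/(_ I): eqXY; rewrite finset.in_set sI finset.in_set2.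
  move: (mem _ sK) (mem _ sL) (mem _ sJ) neKL neJK.
  by do 3!case/orP => /eqP ->; rewrite ?eqxx.
by move: (no L); rewrite sL eq_sym neKL.
Qed.

(** As [0^-1 = 0], an average over a cell of measure zero is zero. *)
Lemma cell_measure_gt0 (f : 'rV[R]_d -> R) K :
  cell_average f K != 0 -> 0 < cell_measure K.
Proof.
move=> avg_neq0; rewrite lt0r volume_ge0 andbT.
by apply: contraNneq avg_neq0; rewrite /cell_average => ->; rewrite invr0 mul0r.
Qed.

(** Positive when mass leaves [K]; the centered convective flux minus the
    diffusive one, so that the mass equation times [|K|] is in conservative
    form. *)
Definition numerical_flux rho u (lam : face M -> R) s K : R :=
  face_measure s *
    (dot (avg (fun L => rho L *: u L) s K) (normal s K) - lam s * jump rho s K).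

(** The coefficients of the two densities have the signs of an M-matrix as
    soon as [lam s] dominates half the normal velocities. *)
Lemma numerical_fluxE rho u lam s K L :
  s \in faces K -> s \in faces L -> K != L ->
  numerical_flux rho u lam s K = face_measure s *
    ((dot (u K) (normal s K) / 2 + lam s) * rho K +
     (dot (u L) (normal s K) / 2 - lam s) * rho L).
Proof.
move=> sK sL neKL; rewrite /numerical_flux /avg /jump (neighborE sK sL neKL).
by rewrite dotZl dotDl !dotZl; congr (_ * _); field.
Qed.

Lemma numerical_flux_opp rho u lam s K L :
  s \in faces K -> s \in faces L -> K != L ->
  numerical_flux rho u lam s L = - numerical_flux rho u lam s K.
Proof.
move=> sK sL neKL; rewrite (numerical_fluxE _ _ _ sK sL neKL).
rewrite (numerical_fluxE _ _ _ sL sK) 1?eq_sym //.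
by rewrite (normal_opposite sK sL (elimN eqP neKL)) !dotNr; field.
Qed.

Lemma numerical_flux_le0 rho u (lam : face M -> R) s K L :
  s \in faces K -> s \in faces L -> K != L ->
  `|dot (u K) (normal s K)| / 2 <= lam s ->
  `|dot (u L) (normal s K)| / 2 <= lam s ->
  rho K <= 0 -> 0 <= rho L -> numerical_flux rho u lam s K <= 0.
Proof.
move=> sK sL neKL lamK lamL rK rL; rewrite (numerical_fluxE _ _ _ sK sL neKL).
apply: mulr_ge0_le0; first exact: volume_ge0.
rewrite -[leRHS]addr0 lerD //.
  apply: mulr_ge0_le0 => //; have := lerNnormlW (lexx `|dot (u K) (normal s K)|).
  by move: lamK; lra.
apply: mulr_le0_ge0 => //; have := ler_norm (dot (u L) (normal s K)).
by move: lamL; lra.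
Qed.

Lemma diffusion_coef_ge B rho u s K L :
  s \in faces K -> s \in faces L -> K != L ->
  `|dot (u K) (normal s K)| / 2 <= diffusion_coef B rho u s K /\
  `|dot (u L) (normal s K)| / 2 <= diffusion_coef B rho u s K.
Proof.
move=> sK sL neKL; rewrite /diffusion_coef (neighborE sK sL neKL).
rewrite (normal_opposite sK sL (elimN eqP neKL)) !dotNr !normrN.
by rewrite !le_max !lexx !orbT.
Qed.

Lemma mass_equation_balance dt rho rho' u lam :
  dt != 0 -> mass_equation dt rho rho' u lam ->
  forall K, cell_measure K != 0 ->
  cell_measure K * rho' K +
    dt * (\sum_(s in faces K) numerical_flux rho' u lam s K) =
  cell_measure K * rho K.
Proof.
move=> dt0 mass K m0; have := mass K.
have -> : \sum_(s in faces K) numerical_flux rho' u lam s K = cell_measure K *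
    (div_h (fun L => rho' L *: u L) K - \sum_(s in faces K)
       face_measure s / cell_measure K * lam s * jump rho' s K).
  rewrite -sumrB mulr_sumr; apply: eq_bigr => s _.
  by rewrite /numerical_flux; field.
rewrite -addrA; set X := div_h _ _ - _ => eq0.
have -> : X = - ((rho' K - rho K) / dt) by apply/eqP; rewrite -addr_eq0 addrC eq0.
by field.
Qed.

Lemma mass_equation_gt0 dt rho rho' u (lam : face M -> R) :
  0 < dt -> (forall K, 0 < cell_measure K) ->
  (forall s K L, s \in faces K -> s \in faces L -> K != L ->
    `|dot (u K) (normal s K)| / 2 <= lam s /\
    `|dot (u L) (normal s K)| / 2 <= lam s) ->
  mass_equation dt rho rho' u lam ->
  (forall K, 0 < rho K) -> forall K, 0 < rho' K.
Proof.
move=> dt0 m0 lam_ge mass rho_gt0.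
apply: (@conservative_scheme_gt0 _ _ _ (@faces _ _ M) (@cell_measure _ _ M) dt
  (numerical_flux rho' u lam) rho) => //.
- exact: face_two_cells.
- by move=> s K L; exact: numerical_flux_opp.
- move=> s K L sK sL neKL rK rL; have [lamK lamL] := lam_ge s K L sK sL neKL.
  exact: numerical_flux_le0 lamL rK (ltW rL).
- move=> K.
  exact: (mass_equation_balance (lt0r_neq0 dt0) mass (lt0r_neq0 (m0 K))).
Qed.

End MassFlux.

Theorem theorem3p1 (R : realType) (d : nat) (hd : (1 <= d <= 3)%N)
    (M : mesh R d) (N : nat) (T : R) (t : nat -> R)
    (ht0 : t 0%N = 0) (htN : t N = T)
    (ht : forall n, (n < N)%N -> t n < t n.+1)
    (rho0 : 'rV[R]_d -> R) (u0 : 'rV[R]_d -> 'rV[R]_d)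
    (hrho0 : initial_datum M rho0)
    (hu0 : forall j, initial_datum M (fun x => u0 x 0 j))
    (rho : nat -> Qh M) (u : nat -> Qhd M)
    (rho_init : rho 0%N = cell_average rho0)
    (u_init : u 0%N = cell_average_vec u0)
    (rho_init_pos : forall K, 0 < rho 0%N K)
    (lam : nat -> face M -> R)
    (hlam0 : forall n s, (n < N)%N -> 0 <= lam n s)
    (hmass : forall n, (n < N)%N ->
      mass_equation (t n.+1 - t n) (rho n) (rho n.+1) (u n.+1) (lam n))
    (B : R -> R)
    (hBder : forall x, derivable B x 1)
    (hBcont : continuous (derive1 B))
    (hBconv : convex_function [set: R] B)
    (hlam : forall n (K : cell M) s, (n < N)%N -> s \in faces K ->
      lam n s = diffusion_coef B (rho n.+1) (u n.+1) s K) :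
  forall n, (1 <= n <= N)%N -> forall K, 0 < rho n K.
Proof.
have m_gt0 (K : cell M) : 0 < cell_measure K.
  by apply: (cell_measure_gt0 (f := rho0)); rewrite -rho_init lt0r_neq0.
have rho_gt0 n : (n <= N)%N -> forall K, 0 < rho n K.
  elim: n => [_|n IHn ltnN]; first exact: rho_init_pos.
  apply: (mass_equation_gt0 _ m_gt0 _ (hmass _ ltnN) (IHn (ltnW ltnN))).
    by rewrite subr_gt0 ht.
  by move=> s K L sK sL neKL; rewrite (hlam _ _ _ ltnN sK); exact: diffusion_coef_ge.
by move=> n /andP[_ lenN]; exact: rho_gt0.
Qed.
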